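(* Let $g$ be a polynomial with rational coefficients, of odd prime degree, that is irreducible over $\mathbb{Q}$ and has more than one real root. Then none of the roots of $g$ can be obtained on the real calculator.
   Context: A real number $x$ can be obtained on the real calculator if there is a finite sequence of real numbers ending with $x$, each term of which is either $1$, or the sum, difference, product or quotient (with nonzero divisor) of two earlier terms, or the real $n$-th root of an earlier term for some integer $n\ge 2$ (where for even $n$ the earlier term must be nonnegative). All numbers involved are real. *)

(* Defs.v *)
From HB Require Import structures.
From mathcomp Require Import all_boot all_order all_algebra.
From mathcomp Require Import reals.

Set Implicit Arguments.
Unset Strict Implicit.
Unset Printing Implicit Defensive.

Import Order.TTheory GRing.Theory Num.Theory.
Local Open Scope ring_scope.

(* For n >= 1, [is_real_nth_root n a y] determines y from a; it has no solution
   y exactly when n is even and a < 0.  For even n the root is the nonnegative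
   one, as with [Num.sqrt]. *)
Definition is_real_nth_root (R : realType) (n : nat) (a y : R) : Prop :=
  y ^+ n = a /\ (~~ odd n -> 0 <= a /\ 0 <= y).

Definition calculator_step (R : realType) (earlier : seq R) (y : R) : Prop :=
  [\/ y = 1,
      exists a b : R, [/\ a \in earlier, b \in earlier
        & [\/ y = a + b, y = a - b, y = a * b | b != 0 /\ y = a / b]]
    | exists (a : R) (n : nat),
        [/\ a \in earlier, (2 <= n)%N & is_real_nth_root n a y]].

Definition calculator_sequence (R : realType) (s : seq R) : Prop :=
  forall i : nat, (i < size s)%N -> calculator_step (take i s) (nth 0 s i).

Definition calculator_obtainable (R : realType) (x : R) : Prop :=
  exists s : seq R, calculator_sequence (rcons s x).

Definition real_root (R : realType) (g : {poly rat}) (x : R) : Prop :=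
  root (map_poly (@ratr R) g) x.

(* Main.v *)
Require Import Defs.
From HB Require Import structures.
From mathcomp Require Import all_boot all_order all_algebra all_field.
From mathcomp Require Import boolp reals.

Set Implicit Arguments.
Unset Strict Implicit.
Unset Printing Implicit Defensive.

Import Order.TTheory GRing.Theory Num.Theory.
Local Open Scope ring_scope.

(** Write p for the degree of g.  If a root x of g could be obtained, x would lie
in a field reached from the rationals by successively adjoining real radicals.
The proof shows that such adjunctions never make g reducible: x keeps degree p
over every field of the tower, whereas an element of a field has degree 1 over
it.

It suffices to adjoin a with a ^+ q in K for a prime q.  For real a, either a
lies in K or a has degree exactly q over K ([prime_radical_degree]).  Suppose the
degree d of x falls below p over K(a).  Computing [K(a, x) : K] through K(a) and
through K(x) gives d * q = e * p, where e is the degree of a over K(x); hence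
q = p and e = d < p.  Applied over K(x), the dichotomy forces e = 1, so
K(x) = K(a) ([radical_degree_drop]).  Thus a = h(x) and x = f(a) with f and h
over K.  Let y be another real root of g, hence another root of the minimal
polynomial of x.  The relation h(x) ^+ p = a ^+ p passes to y, and since p is
odd and everything is real, h(y) = a; the relation f(h(x)) = x passes to y as
well, so y = f(h(y)) = f(a) = x ([prime_radical_adjoin_degree]).  This is where
a second real root is incompatible with real radicals.

All fields are taken inside one number field embedded in the reals, built by
adjoining the numbers of the calculator sequence one by one
([calculator_number_field]), so that degrees are dimensions of subspaces. *)

(** * Powers in ordered and arbitrary fields *)

Lemma expr_eq_opp_or (R : realDomainType) (n : nat) (x y : R) :
  (0 < n)%N -> x ^+ n = y ^+ n -> x = y \/ x = - y.
Proof.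
move=> n_gt0 Exy; have /eqP: `|x| ^+ n == `|y| ^+ n by rewrite -!normrX Exy.
move/(pexpIrn n_gt0); rewrite !nnegrE !normr_ge0 => /(_ isT isT)/eqP.
by rewrite eqr_norm2 => /orP[] /eqP; [left | right].
Qed.

Lemma odd_expr_inj (R : realDomainType) (n : nat) :
  odd n -> injective (fun x : R => x ^+ n).
Proof.
move=> n_odd x y /= Exy; have n_gt0 := odd_gt0 n_odd.
case: (expr_eq_opp_or n_gt0 Exy) => // Dx.
move: Exy; rewrite Dx exprNn -signr_odd n_odd mulN1r => /eqP.
by rewrite eqNr expf_eq0 n_gt0 => /eqP->; rewrite oppr0.
Qed.

Lemma det_exprn (F : comNzRingType) (n q : nat) (A : 'M[F]_n.+1) :
  \det (A ^+ q) = \det A ^+ q.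
Proof.
by elim: q => [|q IHq]; rewrite ?expr0 ?det1 // !exprS det_mulmx IHq.
Qed.

(** By Cayley-Hamilton, such a matrix satisfies A ^+ q = b%:M; take
determinants. *)
Lemma char_poly_dvd_binomial_det (F : fieldType) (n q : nat) (b : F)
    (A : 'M[F]_n) :
  (0 < n)%N -> char_poly A %| 'X^q - b%:P -> \det A ^+ q = b ^+ n.
Proof.
case: n A => // n A _ /dvdpP[r /(congr1 (horner_mx A))].
rewrite rmorphM /= Cayley_Hamilton mulr0 rmorphB rmorphXn /= horner_mx_X.
rewrite horner_mx_C => /eqP; rewrite subr_eq0 => /eqP/(congr1 determinant).
by rewrite det_exprn det_scalar.
Qed.

(** In a splitting field the left-hand base is the product of the roots of f, all
of which are q-th roots of b.  The companion matrix of f, whose determinant is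
that product, makes the splitting field unnecessary. *)
Lemma dvd_binomial_coef0 (F : fieldType) (q : nat) (b : F) (f : {poly F}) :
  f \is monic -> (1 < size f)%N -> f %| 'X^q - b%:P ->
  ((-1) ^+ (size f).-1 * f`_0) ^+ q = b ^+ (size f).-1.
Proof.
move=> f_mon f_gt1 f_dvd.
have d_gt0 : (0 < (size f).-1)%N by case: (size f) f_gt1 => [|[]].
have Cf := companionmxK f_mon.
rewrite -(@char_poly_dvd_binomial_det _ _ q b (companionmx f)) ?Cf //.
by rewrite -[in f`_0]Cf char_poly_det signrMK.
Qed.

Lemma aspace_coprime_exp (F : fieldType) (E : fieldExtType F)
    (K : {subfield E}) (a : E) (d q : nat) :
  (0 < d)%N -> coprime d q -> a ^+ d \in K -> a ^+ q \in K -> a \in K.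
Proof.
move=> d_gt0 co_dq Kad Kaq; have [->|nz_a] := eqVneq a 0; first exact: mem0v.
case: (egcdnP q d_gt0) => u v Duv _.
have: a ^+ (u * d) \in K by rewrite mulnC exprM rpredX.
rewrite Duv (eqP co_dq) exprD expr1 mulnC exprM => Kprod.
by rewrite -(mulKf (expf_neq0 v (expf_neq0 q nz_a)) a) rpredM // rpredV rpredX.
Qed.

(** * Adjoining real radicals *)

Section RealEmbedding.

Variables (F : fieldType) (E : fieldExtType F) (R : realDomainType).
Variable iota : {rmorphism E -> R}.
Implicit Types (K : {subfield E}) (a x y : E) (g : {poly E}).

(** If a has degree d < q, the norm c of a over K satisfies
c ^+ q = (a ^+ q) ^+ d = (a ^+ d) ^+ q.  By the real embedding c is a ^+ d up to
sign, so K contains a ^+ d as well as a ^+ q, and d is coprime to q. *)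
Lemma prime_radical_degree K a (q : nat) :
  prime q -> a ^+ q \in K -> a \in K \/ adjoin_degree K a = q.
Proof.
move=> q_pr Kaq; set d := adjoin_degree K a; have q_gt0 := prime_gt0 q_pr.
have binK : 'X^q - (a ^+ q)%:P \is a polyOver K.
  by rewrite rpredB ?rpredX ?polyOverX ?polyOverC.
have f_dvd : minPoly K a %| 'X^q - (a ^+ q)%:P.
  by rewrite minPoly_dvdp // rootE !hornerE subrr.
have size_f := size_minPoly K a; rewrite -/d in size_f.
have d_gt0 : (0 < d)%N by [].
have : (d <= q)%N.
  have := dvdp_leq _ f_dvd; rewrite size_f size_XnsubC // ltnS; apply.
  by rewrite -size_poly_eq0 size_XnsubC.
rewrite leq_eqVlt => /orP[/eqP|lt_dq]; [by right | left].
have co_dq : coprime d q.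
  by rewrite coprime_sym prime_coprime // gtnNdvd.
have := dvd_binomial_coef0 (monic_minPoly K a) _ f_dvd.
rewrite size_f /= => /(_ isT); set c := _ * _ => Ec.
have Kc : c \in K.
  by rewrite rpredM ?rpredX ?rpredN ?rpred1 // (polyOverP (minPolyOver K a)).
apply: aspace_coprime_exp d_gt0 co_dq _ Kaq.
move/(congr1 iota): Ec; rewrite exprAC !(rmorphXn iota).
case/(expr_eq_opp_or q_gt0); rewrite -?rmorphXn -?rmorphN => /fmorph_inj Ec.
  by rewrite -Ec.
by rewrite -[_ ^+ d]opprK -Ec rpredN.
Qed.

(** The degree condition says that g is irreducible over K. *)
Lemma minPoly_conjugate K g x y :
  g \is a polyOver K -> adjoin_degree K x = (size g).-1 ->
  root g x -> root g y -> minPoly K y = minPoly K x.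
Proof.
move=> Kg deg_x gx gy; have szx := size_minPoly K x.
have eq_gx : minPoly K x %= g.
  rewrite -dvdp_size_eqp ?minPoly_dvdp // szx deg_x prednK //.
  by case: (size g) deg_x.
have y_dvd_x : minPoly K y %| minPoly K x.
  by rewrite (eqp_dvdr _ eq_gx) minPoly_dvdp.
have /orP[|/eqp_size] := minPoly_irr (minPolyOver K y) y_dvd_x.
  by rewrite eqp_monic ?monic_minPoly // => /eqP.
by rewrite size_minPoly size_poly1.
Qed.

(** Both ways of computing [K(a, x) : K] agree; as the degree of x over K(a) is
smaller than p, the factor p must come from q. *)
Lemma radical_degree_drop K a x (p q : nat) :
  prime p -> prime q -> a ^+ q \in K -> adjoin_degree K x = p ->
  adjoin_degree <<K; a>>%AS x <> p ->
  [/\ q = p, x \in <<K; a>>%VS & a \in <<K; x>>%VS].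
Proof.
move=> p_pr q_pr Kaq deg_x /eqP deg_x'; set d := adjoin_degree _ x in deg_x' *.
have lt_dp : (d < p)%N.
  rewrite ltn_neqAle deg_x' -ltnS -deg_x -!size_minPoly dvdp_leq //.
    exact/monic_neq0/monic_minPoly.
  by apply: minPolyS; rewrite subv_adjoin.
have deg_a : adjoin_degree K a = q.
  case: (prime_radical_degree q_pr Kaq) => // Ka; case/eqP: deg_x'.
  by rewrite -deg_x /d /=; move/Fadjoin_idP: Ka => ->.
set e := adjoin_degree <<K; x>>%AS a.
(* [K(a, x) : K(a)] [K(a) : K] = [K(x, a) : K(x)] [K(x) : K]. *)
have Edeg : (d * q = e * p)%N.
  apply/eqP; rewrite -(eqn_pmul2r (adim_gt0 K)) -!mulnA -{1}deg_a -{1}deg_x.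
  have := dim_Fadjoin <<K; x>>%AS a; rewrite /= adjoinC.
  by rewrite (dim_Fadjoin <<K; a>>%AS x) /= !dim_Fadjoin -/d -/e => ->.
have co_pd : coprime p d by rewrite prime_coprime // gtnNdvd.
have Eqp : q = p.
  apply/eqP; rewrite eq_sym -dvdn_prime2 // -(Gauss_dvdr _ co_pd) Edeg.
  exact: dvdn_mull.
have Eed : e = d.
  by apply/eqP; rewrite -(eqn_pmul2r (prime_gt0 p_pr)) -Edeg Eqp.
have Kxa : a \in <<K; x>>%AS.
  case: (@prime_radical_degree <<K; x>>%AS a q) => //.
    by rewrite (subvP (subv_adjoin K x)).
  by rewrite -/e Eed Eqp => Edp; rewrite Edp eqxx in deg_x'.
split=> //; rewrite -(adjoin_deg_eq1 <<K; a>>%AS) -/d -Eed.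
by rewrite (adjoin_deg_eq1 <<K; x>>%AS).
Qed.

(** If the degree dropped, K(x) = K(a), with a the only p-th root of a ^+ p in E;
so x would be the only root of g in E. *)
Lemma prime_radical_adjoin_degree K g a x y (q : nat) :
  prime (size g).-1 -> odd (size g).-1 -> g \is a polyOver K ->
  root g x -> root g y -> x != y -> prime q -> a ^+ q \in K ->
  adjoin_degree K x = (size g).-1 ->
  adjoin_degree <<K; a>>%AS x = (size g).-1.
Proof.
move=> p_pr p_odd Kg gx gy neq_xy q_pr Kaq deg_x; apply/eqP/idPn => /eqP deg_x'.
have [Eq Kax Kxa] := radical_degree_drop p_pr q_pr Kaq deg_x deg_x'.
rewrite Eq in Kaq => {q q_pr Eq}; case/eqP: neq_xy.
(* Over K, x and y have the same minimal polynomial. *)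
have transfer f : f \is a polyOver K -> root f x -> root f y.
  move=> Kf fx; have := root_minPoly K y.
  rewrite (minPoly_conjugate Kg deg_x gx gy).
  exact: (root_dvdp (minPoly_dvdp Kf fx)).
have /Fadjoin_polyP[h Kh Ea] := Kxa; have /Fadjoin_polyP[f Kf Ex] := Kax.
have hy : h.[y] = a.
  have: root (h ^+ (size g).-1 - (a ^+ (size g).-1)%:P) y.
    apply: transfer; last by rewrite rootE !hornerE -Ea subrr.
    by rewrite rpredB ?rpredX ?polyOverC.
  rewrite rootE !hornerE subr_eq0 => /eqP/(congr1 iota).
  by rewrite !rmorphXn => /(odd_expr_inj p_odd)/fmorph_inj.
have: root (f \Po h - 'X) y.
  apply: transfer; last by rewrite rootE !hornerE horner_comp -Ea -Ex subrr.
  by rewrite rpredB ?polyOver_comp ?polyOverX.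
by rewrite rootE !hornerE horner_comp hy -Ex subr_eq0 => /eqP.
Qed.

(** Peel off one prime factor q of n: first adjoin a ^+ (n %/ q), a prime radical
over K, and then a, whose exponent is now n %/ q. *)
Lemma radical_adjoin_degree K g a x y (n : nat) :
  prime (size g).-1 -> odd (size g).-1 -> g \is a polyOver K ->
  root g x -> root g y -> x != y -> (0 < n)%N -> a ^+ n \in K ->
  adjoin_degree K x = (size g).-1 ->
  exists2 L : {subfield E}, (K <= L)%VS /\ a \in L
    & adjoin_degree L x = (size g).-1.
Proof.
move=> p_pr p_odd + gx gy neq_xy.
elim/ltn_ind: n K => n IHn K Kg n_gt0 Kan deg_x.
have [le_n1|n_gt1] := leqP n 1.
  have Dn1 : n = 1%N by apply/eqP; rewrite eqn_leq le_n1.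
  by exists K => //; rewrite Dn1 in Kan.
have q_pr := pdiv_prime n_gt1; set q := pdiv n in q_pr.
have Dn : n = (n %/ q * q)%N by rewrite divnK ?pdiv_dvd.
have m_gt0 : (0 < n %/ q)%N by rewrite divn_gt0 ?prime_gt0 // dvdn_leq ?pdiv_dvd.
rewrite Dn exprM in Kan; set c := a ^+ (n %/ q) in Kan.
have [] := IHn (n %/ q)%N _ <<K; c>>%AS; rewrite ?ltn_Pdiv ?prime_gt1 //.
- by apply: polyOverSv Kg; apply: subv_adjoin.
- exact: memv_adjoin.
- exact: (prime_radical_adjoin_degree p_pr p_odd Kg gx gy neq_xy q_pr Kan).
by move=> L [sKcL La] deg_L; exists L => //; have /FadjoinP[] := sKcL.
Qed.

End RealEmbedding.

(** * Number fields containing given algebraic elements *)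

Lemma adjoin_degree_irreducible (F : fieldType) (E : fieldExtType F)
    (g : {poly F}) (x : E) :
  irreducible_poly g -> root (map_poly (in_alg E) g) x ->
  adjoin_degree 1%AS x = (size g).-1.
Proof.
move=> [_ g_irr] gx; have /polyOver1P[p Dp] := minPolyOver 1%AS x.
have szp : size p = (adjoin_degree 1%AS x).+1.
  by rewrite -size_minPoly Dp size_map_poly.
have p_dvd : p %| g.
  by rewrite -(dvdp_map (in_alg E)) -Dp minPoly_dvdp // alg_polyOver.
by have /eqp_size <- : p %= g; [apply: g_irr; rewrite ?szp | rewrite szp].
Qed.

(** Take r of minimal size; the choice of the minimal size is classical, since F
and L come with no decision procedure for algebraicity. *)
Lemma exists_irreducible_root (F L : fieldType) (iota : {rmorphism F -> L})
    (p : {poly F}) (z : L) :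
  p != 0 -> root (map_poly iota p) z ->
  exists2 r : {poly F}, irreducible_poly r & root (map_poly iota r) z.
Proof.
move=> nz_p pz.
pose degs n := `[< exists r, [/\ r != 0, root (map_poly iota r) z & size r = n] >].
have ex_degs : exists n, degs n by exists (size p); apply/asboolP; exists p.
case: (ex_minnP ex_degs) => n /asboolP[r [nz_r rz szr]] min_n.
exists r => //; apply/(subfx_irreducibleP rz nz_r) => q qz nz_q.
by rewrite szr; apply: min_n; apply/asboolP; exists q.
Qed.

Lemma adjoin_algebraic (F L : fieldType) (E : fieldExtType F)
    (iota : {rmorphism E -> L}) (p : {poly E}) (z : L) :
  p != 0 -> root (map_poly iota p) z ->
  exists (E' : fieldExtType F) (iota' : {rmorphism E' -> L}),
    (forall e, exists e', iota' e' = iota e) /\ exists z', iota' z' = z.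
Proof.
move=> nz_p pz; have [r r_irr rz] := exists_irreducible_root nz_p pz.
have nz_r := irredp_neq0 r_irr.
pose E1 := SubFieldExtType rz r_irr.
pose iota1 : {rmorphism E1 -> L} := @subfx_inj _ _ iota z r.
exists (baseFieldType E1), iota1; split=> [e|].
  by exists (e%:A : E1); apply: subfx_inj_base.
by exists (subfx_root iota z r); apply: subfx_inj_root.
Qed.

(** * Calculator sequences *)

Section Calculator.

Variable R : realType.
Implicit Types (s : seq R) (x y z : R).

Lemma calculator_sequence_rcons s z :
  calculator_sequence (rcons s z) ->
  calculator_sequence s /\ calculator_step s z.
Proof.
move=> calc; split=> [i lt_is|].
  have := calc i; rewrite size_rcons ltnS nth_rcons lt_is => /(_ (ltnW lt_is)).
  by rewrite -cats1 takel_cat // ltnW.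
have := calc (size s); rewrite size_rcons nth_rcons ltnn eqxx => /(_ (ltnSn _)).
by rewrite -cats1 take_size_cat.
Qed.

(** Only the root steps enlarge the field: a root of iota a1 is algebraic over the
image of E1, as a zero of 'X^n - a1. *)
Lemma calculator_number_field s (E : fieldExtType rat)
    (iota : {rmorphism E -> R}) :
  calculator_sequence s ->
  exists (E' : fieldExtType rat) (iota' : {rmorphism E' -> R}),
    (forall e, exists e', iota' e' = iota e) /\
    {in s, forall z, exists z' : E', iota' z' = z}.
Proof.
elim/last_ind: s => [|s z IHs]; first by exists E, iota; split=> // e; exists e.
case/calculator_sequence_rcons=> /IHs[E1 [iota1 [sub1 im_s]]] step_z.
suffices [E2 [iota2 [sub2 im_z]]] :
    exists (E2 : fieldExtType rat) (iota2 : {rmorphism E2 -> R}),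
      (forall e, exists e', iota2 e' = iota1 e) /\ exists z' : E2, iota2 z' = z.
  exists E2, iota2; split=> [e|u].
    by have [e1 <-] := sub1 e; apply: sub2.
  by rewrite mem_rcons inE => /predU1P[->//|/im_s[u1 <-]].
have self : forall e, exists e', iota1 e' = iota1 e by move=> e; exists e.
case: step_z => [->|[a [b [/im_s[a1 <-] /im_s[b1 <-] op]]]|[a [n]]].
- by exists E1, iota1; split=> //; exists 1; rewrite rmorph1.
- exists E1, iota1; split=> //; case: op => [->|->|->|[_ ->]].
  + by exists (a1 + b1); rewrite rmorphD.
  + by exists (a1 - b1); rewrite rmorphB.
  + by exists (a1 * b1); rewrite rmorphM.
  + by exists (a1 / b1); rewrite fmorph_div.
case=> /im_s[a1 <-] n_ge2 [Ezn _]; have n_gt0 := ltnW n_ge2.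
apply: (@adjoin_algebraic _ _ _ _ ('X^n - a1%:P)).
  by rewrite -size_poly_eq0 size_XnsubC.
by rewrite rmorphB /= map_polyXn map_polyC rootE !hornerE Ezn subrr.
Qed.

(** Field operations stay in the current K and root steps are handled by
[radical_adjoin_degree]. *)
Lemma calculator_preserves_degree s (E : fieldExtType rat)
    (iota : {rmorphism E -> R}) (g : {poly E}) (x y : E) :
  prime (size g).-1 -> odd (size g).-1 -> g \is a polyOver 1%VS ->
  root g x -> root g y -> x != y -> adjoin_degree 1%AS x = (size g).-1 ->
  calculator_sequence s -> {in s, forall z, exists z' : E, iota z' = z} ->
  exists2 K : {subfield E}, adjoin_degree K x = (size g).-1
    & forall e, iota e \in s -> e \in K.
Proof.
move=> p_pr p_odd g1 gx gy neq_xy deg_x.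
elim/last_ind: s => [|s z IHs]; first by exists 1%AS.
case/calculator_sequence_rcons=> calc_s step_z im_sz.
have im_s u : u \in s -> exists u' : E, iota u' = u.
  by move=> su; apply: im_sz; rewrite mem_rcons inE su orbT.
have [K deg_K sK] := IHs calc_s im_s.
have [w Ew] : exists w : E, iota w = z.
  by apply: im_sz; rewrite mem_rcons inE eqxx.
suffices [M [sKM Mw] deg_M] : exists2 M : {subfield E},
    (K <= M)%VS /\ w \in M & adjoin_degree M x = (size g).-1.
  exists M => // e; rewrite mem_rcons inE => /predU1P[|/sK]; last first.
    exact: (subvP sKM).
  by rewrite -Ew => /fmorph_inj->.
have Kself : w \in K -> exists2 M : {subfield E},
    (K <= M)%VS /\ w \in M & adjoin_degree M x = (size g).-1.
  by move=> Kw; exists K.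
have back e e' : iota e = iota e' -> e = e' by apply: fmorph_inj.
case: step_z; rewrite -Ew.
- by rewrite -(rmorph1 iota) => /back Dw; apply: Kself; rewrite Dw mem1v.
- case=> a [b [sa sb]]; have [a1 Ea] := im_s a sa; have [b1 Eb] := im_s b sb.
  move: sa sb; rewrite -Ea -Eb => /sK Ka /sK Kb op; apply: Kself.
  rewrite -rmorphD -rmorphB -rmorphM -fmorph_div in op.
  by case: op => [/back->|/back->|/back->|[_ /back->]];
    rewrite ?rpredB ?rpredD ?rpredM ?rpredV.
case=> a [n [sa n_ge2 [Ewn _]]]; have [a1 Ea] := im_s a sa.
move: sa Ewn; rewrite -Ea -rmorphXn => /sK Ka /back Ewn.
apply: (radical_adjoin_degree iota p_pr p_odd _ gx gy neq_xy (ltnW n_ge2)) => //.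
  by apply: polyOverSv g1; apply: sub1v.
by rewrite Ewn.
Qed.

End Calculator.

Theorem mainTheorem5 (R : realType) (g : {poly rat})
  (g_prime_degree : prime (size g).-1)
  (g_odd_degree : odd (size g).-1)
  (g_irreducible : irreducible_poly g)
  (g_real_roots : exists x y : R, [/\ x != y, real_root g x & real_root g y]) :
  forall x : R, real_root g x -> ~ calculator_obtainable x.
Proof.
move=> x gx [s calc]; have [y neq_xy gy] : exists2 y, x != y & real_root g y.
  case: g_real_roots => u [v [neq_uv gu gv]].
  by have [Dx|] := eqVneq x u; [exists v; rewrite ?Dx | exists u].
have nz_g := irredp_neq0 g_irreducible.
(* The number field must contain the second root y as well as the sequence, so y
   is adjoined before the elements of the sequence. *)
pose iota0 : {rmorphism rat^o -> R} := ratr.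
have [E1 [iota1 [_ [y1 Ey1]]]] := @adjoin_algebraic _ _ _ iota0 g y nz_g gy.
have [E [iota [sub im_s]]] := calculator_number_field iota1 calc.
have [x' Ex] : exists x' : E, iota x' = x.
  by apply: im_s; rewrite mem_rcons inE eqxx.
have [y' Ey] : exists y' : E, iota y' = y by rewrite -Ey1; apply: sub.
pose gE := map_poly (in_alg E) g.
have Dg : map_poly iota gE = map_poly ratr g.
  rewrite -map_poly_comp; apply: eq_map_poly => c.
  exact: (fmorph_eq_rat (iota \o in_alg E)).
have gEx : root gE x' by rewrite -(fmorph_root iota) Dg Ex.
have gEy : root gE y' by rewrite -(fmorph_root iota) Dg Ey.
have szg : size gE = size g by rewrite size_map_poly.
have neq_xy' : x' != y'.
  by apply: contraNneq neq_xy => Dx'; rewrite -Ex -Ey Dx'.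
have deg_x := adjoin_degree_irreducible g_irreducible gEx.
have [||||K deg_K Ks] := calculator_preserves_degree _ _ _ gEx gEy neq_xy' _ calc im_s.
- by rewrite szg.
- by rewrite szg.
- exact: alg_polyOver.
- by rewrite szg.
(* x' lies in K, so its degree over K is 1, which is not prime. *)
have Kx : x' \in K by apply: Ks; rewrite Ex mem_rcons inE eqxx.
move: g_prime_degree; rewrite -szg -deg_K.
by rewrite -(adjoin_deg_eq1 K) in Kx; rewrite (eqP Kx).
Qed.
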